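(* The monomials in $\mathfrak{pvb}_n^!$ corresponding to Up-Down forests on $[n]=\{1,\dots,n\}$ form a basis of $\mathfrak{pvb}_n^!$ (each monomial determined up to sign).
   Context: $\mathfrak{pvb}_n^!$ is the graded $\mathbb{Q}$-algebra obtained as the quotient of the exterior algebra on degree-1 generators $r_{ij}$, $1\le i\ne j\le n$, by the ideal generated by $r_{ij}\wedge r_{ik}=r_{ij}\wedge r_{jk}-r_{ik}\wedge r_{kj}$, $r_{ik}\wedge r_{jk}=r_{ij}\wedge r_{jk}-r_{ji}\wedge r_{ik}$ (for $i,j,k$ distinct) and $r_{ij}\wedge r_{ji}=0$. A set of directed edges $(a,b)$ on $[n]$ corresponds to the monomial $\bigwedge r_{ab}$ over its edges. An Up tree on a finite set $S\subseteq\mathbb{N}$ is a set of $|S|-1$ directed edges $(a,b)$ with $a<b$, $a,b\in S$, forming a tree in which every element of $S$ other than $\min S$ has exactly one incoming edge (for $|S|=1$ it is empty); Up trees on $S$ are in bijection with cyclic orderings of $S$. A Down tree on a finite set $T\subseteq\mathbb{N}$ with minimum $\mu$ is the set of edges $(t,\mu)$, $t\in T\setminus\{\mu\}$. An Up-Down forest on $[n]$ is obtained by choosing an unordered set partition $[n]=S_1\sqcup\cdots\sqcup S_l$, an Up tree on each $S_i$, and an unordered set partition $\{\min S_1,\dots,\min S_l\}=M_1\sqcup\cdots\sqcup M_k$, and taking the union of the chosen Up trees with the Down trees on the $M_j$. *)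

(* Defs.v *)
From mathcomp Require Import all_boot all_order all_algebra.
Set Implicit Arguments. Unset Strict Implicit. Unset Printing Implicit Defensive.
Import Order.TTheory GRing.Theory Num.Theory.
Local Open Scope ring_scope.

(* The vertex set [n] = {1,...,n} is modelled by 'I_n = {0,...,n-1}
   (an order-preserving relabelling).  Generators r_ij (i <> j) are
   indexed by the finite type [gen n] of ordered pairs of distinct vertices. *)
Definition gen (n : nat) := {p : 'I_n * 'I_n | p.1 != p.2}.

(* Exterior algebra Lambda(Q^{gen n}) in coordinates: an element is a
   Q-valued function on subsets S of generators (coefficient of e_S, the
   wedge of the generators of S in increasing [enum_rank] order). *)
Notation ext n := {ffun {set gen n} -> rat}.

Definition emon n (S : {set gen n}) : ext n := [ffun T => (T == S)%:R].

Definition ninv n (S T : {set gen n}) : nat :=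
  #|[set p in setX S T | (enum_rank p.2 < enum_rank p.1)%N]|.

Definition wedge n (x y : ext n) : ext n :=
  [ffun U => \sum_(S : {set gen n}) \sum_(T : {set gen n})
     if [disjoint S & T] && (S :|: T == U)
     then (-1) ^+ ninv S T * x S * y T else 0].

(* generator r_ij (only used for i <> j) *)
Definition rgen n (i j : 'I_n) : ext n :=
  if @insub _ (fun p : 'I_n * 'I_n => p.1 != p.2) _ (i, j) is Some g
  then emon [set g] else 0.

Definition is_rel n (rho : ext n) : Prop :=
  (exists i j k : 'I_n, [/\ i != j, i != k & j != k] /\
     (rho = wedge (rgen i j) (rgen i k)
            - (wedge (rgen i j) (rgen j k) - wedge (rgen i k) (rgen k j))
      \/ rho = wedge (rgen i k) (rgen j k)
            - (wedge (rgen i j) (rgen j k) - wedge (rgen j i) (rgen i k))))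
  \/ (exists i j : 'I_n, i != j /\ rho = wedge (rgen i j) (rgen j i)).

Definition in_ideal n (x : ext n) : Prop :=
  exists s : seq (ext n * ext n * ext n),
    (forall t, t \in s -> is_rel t.1.2) /\
    x = \sum_(t <- s) wedge (wedge t.1.1 t.1.2) t.2.

Definition minb n (S : {set 'I_n}) (m : 'I_n) : bool :=
  (m \in S) && [forall x in S, (m <= x)%N].

Definition adj n (E : {set gen n}) : rel 'I_n :=
  fun x y => [exists e in E, (val e == (x, y)) || (val e == (y, x))].

Definition upb n (S : {set 'I_n}) (E : {set gen n}) : bool :=
  [&& [forall e in E, [&& (val e).1 \in S, (val e).2 \in S
                        & ((val e).1 < (val e).2)%N]],
      #|E| == #|S|.-1,
      [forall v in S, ~~ minb S v ==> (#|[set e in E | (val e).2 == v]| == 1%N)]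
    & [forall v in S, forall m in S, minb S m ==> connect (adj E) m v]].

Definition downb n (T : {set 'I_n}) (E : {set gen n}) : bool :=
  [exists mu, minb T mu &&
     (E == [set e : gen n | [&& (val e).1 \in T, (val e).1 != mu
                               & (val e).2 == mu]])].

Definition minima n (P : {set {set 'I_n}}) : {set 'I_n} :=
  [set m | [exists S in P, minb S m]].

Definition updownb n (E : {set gen n}) : bool :=
  [exists P : {set {set 'I_n}}, exists U : {ffun {set 'I_n} -> {set gen n}},
   exists Q : {set {set 'I_n}}, exists D : {ffun {set 'I_n} -> {set gen n}},
   [&& partition P [set: 'I_n], [forall S in P, upb S (U S)],
       partition Q (minima P), [forall T in Q, downb T (D T)]
     & E == (\bigcup_(S in P) U S) :|: (\bigcup_(T in Q) D T)]].

Definition scal n (k : rat) (x : ext n) : ext n := [ffun T => k * x T].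

(* Main.v *)
(* Call a set E of directed edges reduced if every vertex v has at most one edge
   of E to a smaller vertex, and none when v is the target of a downward edge
   (an edge (a, v) with v < a).  These local conditions describe exactly the
   Up-Down forests.

   Spanning: a violation of the conditions is a pair of edges on two or three
   vertices, and the relations rewrite it into pairs of smaller total weight
   3 (a + b) + [b < a].

   Independence: for a partition of the vertices into blocks and a linear order
   on the vertices, send r_ij to x_j - x_i if i and j share a block and i precedes
   j, and to 0 otherwise.  This kills the relations, hence defines a morphism from
   the algebra to the exterior algebra on the x_v; take the coefficient of the
   product of the x_v over the vertices that are not minimal in their block.
   In a reduced E the largest vertex k carries at most one edge.  Moving k past
   a single vertex u of its block isolates the terms with an edge between k and
   u, and placing k first in its block isolates the terms with a downward edge
   from k, which has to end in the minimum of the block; both reduce to the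
   independence of reduced sets without k. *)
Require Import Defs.
From HB Require Import structures.
From mathcomp Require Import all_boot all_order all_algebra.
From mathcomp Require Import zify.
Set Implicit Arguments. Unset Strict Implicit. Unset Printing Implicit Defensive.
Import Order.TTheory GRing.Theory Num.Theory.
Local Open Scope ring_scope.

(* An alias of [ext] for which [*] is the wedge product: on a bare
   [{ffun {set I} -> rat}] the product is the pointwise one. *)
Definition exterior (I : finType) := {ffun {set I} -> rat^o}.

HB.instance Definition _ (I : finType) := GRing.Lmodule.on (exterior I).

(** Generic versions of [emon] and [ninv]: the exterior algebra is needed both on the edges and on
    the vertices. *)
Definition ebase (I : finType) (S : {set I}) : exterior I :=
  [ffun T => (T == S)%:R].

Definition einv (I : finType) (S T : {set I}) : nat :=
  #|[set p in setX S T | (enum_rank p.2 < enum_rank p.1)%N]|.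

Definition ebase_mul (I : finType) (S T : {set I}) : exterior I :=
  if [disjoint S & T] then (-1) ^+ einv S T *: ebase (S :|: T) else 0.

(** The bilinear form of the definition makes distributivity and scaling immediate; [emul_coef]
    recovers the coefficientwise formula of [wedge]. *)
HB.lock Definition emul (I : finType) (x y : exterior I) : exterior I :=
  \sum_S \sum_T (x S * y T) *: ebase_mul S T.

(** * The exterior algebra on a finite set as an associative algebra *)

Section ExteriorAlgebra.
Variable I : finType.
Implicit Types (x y z : exterior I) (S T U : {set I}).

Lemma eaddE x y S : (x + y) S = x S + y S. Proof. by rewrite ffunE. Qed.

Lemma escaleE (k : rat) x S : (k *: x) S = k * x S.
Proof. by rewrite ffunE. Qed.

Lemma esumE (J : Type) (r : seq J) (P : pred J) (F : J -> exterior I) S :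
  (\sum_(j <- r | P j) F j) S = \sum_(j <- r | P j) F j S.
Proof. by rewrite sum_ffunE. Qed.

Lemma ebaseE S T : ebase S T = (T == S)%:R. Proof. by rewrite ffunE. Qed.

Lemma ebase_expand x : x = \sum_S x S *: ebase S.
Proof.
apply/ffunP => T; rewrite esumE (bigD1 T) //= big1 => [|S /negPf neqST].
  by rewrite escaleE ffunE eqxx mulr1 addr0.
by rewrite escaleE ffunE eq_sym neqST mulr0.
Qed.

Lemma emulDl : left_distributive (@emul I) +%R.
Proof.
move=> x y z; rewrite emul.unlock -big_split; apply: eq_bigr => S _ /=.
by rewrite -big_split; apply: eq_bigr => T _ /=; rewrite eaddE mulrDl scalerDl.
Qed.

Lemma emulDr : right_distributive (@emul I) +%R.
Proof.
move=> x y z; rewrite emul.unlock -big_split; apply: eq_bigr => S _ /=.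
by rewrite -big_split; apply: eq_bigr => T _ /=; rewrite eaddE mulrDr scalerDl.
Qed.

Lemma emulZl (k : rat) x y : k *: emul x y = emul (k *: x) y.
Proof.
rewrite emul.unlock scaler_sumr; apply: eq_bigr => S _.
by rewrite scaler_sumr; apply: eq_bigr => T _; rewrite scalerA escaleE mulrA.
Qed.

Lemma emulZr (k : rat) x y : k *: emul x y = emul x (k *: y).
Proof.
rewrite emul.unlock scaler_sumr; apply: eq_bigr => S _.
by rewrite scaler_sumr; apply: eq_bigr => T _; rewrite scalerA escaleE mulrCA.
Qed.

Lemma emul0l y : emul 0 y = 0.
Proof. by rewrite -[LHS](scale1r) -[in LHS](scale0r 0) -emulZl scale0r scaler0. Qed.

Lemma emul0r y : emul y 0 = 0.
Proof. by rewrite -[LHS](scale1r) -[in LHS](scale0r 0) -emulZr scale0r scaler0. Qed.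

Lemma emul_suml (J : Type) (r : seq J) (P : pred J) (F : J -> exterior I) y :
  emul (\sum_(j <- r | P j) F j) y = \sum_(j <- r | P j) emul (F j) y.
Proof.
exact: (big_morph (fun x => emul x y) (fun u v => emulDl u v y) (emul0l y)).
Qed.

Lemma emul_sumr (J : Type) (r : seq J) (P : pred J) (F : J -> exterior I) y :
  emul y (\sum_(j <- r | P j) F j) = \sum_(j <- r | P j) emul y (F j).
Proof.
exact: (big_morph (emul y) (emulDr y) (emul0r y)).
Qed.

Lemma emul_base S T : emul (ebase S) (ebase T) = ebase_mul S T.
Proof.
rewrite emul.unlock (bigD1 S) //= [X in _ + X]big1 ?addr0 => [|S' /negPf neS].
  rewrite (bigD1 T) //= [X in _ + X]big1 ?addr0 => [|T' /negPf neT].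
    by rewrite !ffunE !eqxx mulr1 scale1r.
  by rewrite !ffunE neT mulr0 scale0r.
by rewrite big1 // => T' _; rewrite !ffunE neS mul0r scale0r.
Qed.

Lemma disjointsUl S T U :
  [disjoint S :|: T & U] = [disjoint S & U] && [disjoint T & U].
Proof. by rewrite -!setI_eq0 setIUl setU_eq0. Qed.

Lemma disjointsUr S T U :
  [disjoint S & T :|: U] = [disjoint S & T] && [disjoint S & U].
Proof. by rewrite -!setI_eq0 setIUr setU_eq0. Qed.

Lemma einvUl S T U : [disjoint S & T] -> einv (S :|: T) U = (einv S U + einv T U)%N.
Proof.
move=> dST; rewrite /einv -cardsUI setIC.
have -> : [set p in setX T U | (enum_rank p.2 < enum_rank p.1)%N]
      :&: [set p in setX S U | (enum_rank p.2 < enum_rank p.1)%N] = set0.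
  apply/setP=> -[a b]; rewrite !inE /=; apply/negP.
  case/andP=> /andP[/andP[aT _] _] /andP[/andP[aS _] _].
  by move: (disjointFr dST aS); rewrite aT.
rewrite cards0 addn0; apply: eq_card => -[a b]; rewrite !inE /=.
by rewrite !andb_orl.
Qed.

Lemma einvUr S T U : [disjoint S & T] -> einv U (S :|: T) = (einv U S + einv U T)%N.
Proof.
move=> dST; rewrite /einv -cardsUI setIC.
have -> : [set p in setX U T | (enum_rank p.2 < enum_rank p.1)%N]
      :&: [set p in setX U S | (enum_rank p.2 < enum_rank p.1)%N] = set0.
  apply/setP=> -[a b]; rewrite !inE /=; apply/negP.
  case/andP=> /andP[/andP[_ aT] _] /andP[/andP[_ aS] _].
  by move: (disjointFr dST aS); rewrite aT.
rewrite cards0 addn0; apply: eq_card => -[a b]; rewrite !inE /=.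
by rewrite andb_orr !andb_orl.
Qed.

Lemma einv0l S : einv set0 S = 0%N.
Proof. by apply/eqP; rewrite cards_eq0; apply/eqP/setP => -[a b]; rewrite !inE. Qed.

Lemma einv0r S : einv S set0 = 0%N.
Proof. by apply/eqP; rewrite cards_eq0; apply/eqP/setP => -[a b]; rewrite !inE andbF. Qed.

(** Both sides vanish unless the three sets are pairwise disjoint; then additivity of [einv] over
    disjoint unions gives both signs the exponent [einv S T + einv S U + einv T U]. *)
Lemma emulA_base S T U :
  emul (ebase S) (emul (ebase T) (ebase U)) =
  emul (emul (ebase S) (ebase T)) (ebase U).
Proof.
rewrite !emul_base /ebase_mul.
have [dTU|ndTU] := ifPn [disjoint T & U]; have [dST|ndST] := ifPn [disjoint S & T].
- rewrite -emulZl -emulZr !emul_base /ebase_mul disjointsUl disjointsUr dST dTU.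
  rewrite andbT /=; case: ifPn => // dSU; last by rewrite !scaler0.
  rewrite !scalerA -!exprD einvUl // einvUr // setUA.
  by congr ((-1) ^+ _ *: _); lia.
- rewrite emul0l -emulZr emul_base /ebase_mul disjointsUr (negPf ndST).
  by rewrite scaler0.
- rewrite emul0r -emulZl emul_base /ebase_mul disjointsUl (negPf ndTU) andbF.
  by rewrite scaler0.
- by rewrite emul0l emul0r.
Qed.

Lemma emulA : associative (@emul I).
Proof.
move=> x y z; rewrite (ebase_expand x) (ebase_expand y) (ebase_expand z).
rewrite !emul_suml; apply: eq_bigr => S _.
rewrite emul_sumr [emul (x S *: _) (\sum_T _)]emul_sumr emul_suml.
apply: eq_bigr => T _.
rewrite !emul_sumr; apply: eq_bigr => U _.
rewrite -!emulZl -!emulZr -!emulZl emulA_base !scalerA.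
by congr (_ *: _); rewrite -!mulrA; congr (_ * _); rewrite mulrC.
Qed.

Lemma emul1l : left_id (ebase set0) (@emul I).
Proof.
move=> x; rewrite [x]ebase_expand emul_sumr; apply: eq_bigr => S _.
rewrite -emulZr emul_base /ebase_mul disjoints_subset sub0set.
by rewrite einv0l scale1r set0U.
Qed.

Lemma emul1r : right_id (ebase set0) (@emul I).
Proof.
move=> x; rewrite [x]ebase_expand emul_suml; apply: eq_bigr => S _.
rewrite -emulZl emul_base /ebase_mul disjoint_sym disjoints_subset sub0set.
by rewrite einv0r scale1r setU0.
Qed.

Lemma ebase0_neq0 : ebase set0 != 0 :> exterior I.
Proof. by apply/eqP => /ffunP/(_ set0); rewrite !ffunE eqxx. Qed.

HB.instance Definition _ := GRing.Zmodule_isNzRing.Build (exterior I)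
  emulA emul1l emul1r emulDl emulDr ebase0_neq0.
HB.instance Definition _ := GRing.Lmodule_isLalgebra.Build rat (exterior I) emulZl.
HB.instance Definition _ := GRing.Lalgebra_isAlgebra.Build rat (exterior I) emulZr.

Lemma ebaseM S T : ebase S * ebase T = ebase_mul S T.
Proof. exact: emul_base. Qed.

Lemma ebase_setD1 g S : g \in S ->
  ebase S = (-1) ^+ einv [set g] (S :\ g) *: (ebase [set g] * ebase (S :\ g)).
Proof.
move=> gS; rewrite ebaseM /ebase_mul disjoints1 !inE eqxx /= setD1K // scalerA.
by rewrite -expr2 sqrr_sign scale1r.
Qed.

Lemma emul_coef x y U :
  (x * y) U = \sum_(S : {set I}) \sum_(T : {set I})
     if [disjoint S & T] && (S :|: T == U)
     then (-1) ^+ einv S T * x S * y T else 0.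
Proof.
rewrite -[x * y]/(emul x y) emul.unlock esumE; apply: eq_bigr => S _; rewrite esumE; apply: eq_bigr => T _.
rewrite escaleE /ebase_mul; case: ifP => _; last by rewrite ffunE mulr0.
rewrite escaleE ffunE eq_sym /=; case: eqP => _; rewrite ?mulr0 // mulr1.
by rewrite mulrC mulrA.
Qed.

End ExteriorAlgebra.

Lemma wedgeE n (x y : ext n) : wedge x y = (x : exterior (gen n)) * y :> exterior _.
Proof. by apply/ffunP => U; rewrite emul_coef ffunE. Qed.

(** * The universal property of the exterior algebra *)

Section UniversalProperty.
Variables (I : finType) (B : algType rat) (f : I -> B).
Hypothesis f_sqr : forall i, f i * f i = 0.
Hypothesis f_anti : forall i j, f i * f j = - (f j * f i).
Implicit Types (S T : {set I}) (x y : exterior I).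

Definition elift x : B := \sum_S x S *: \prod_(i in S) f i.

Lemma elift_is_linear : linear elift.
Proof.
move=> k x y; rewrite /elift scaler_sumr -big_split; apply: eq_bigr => S _ /=.
by rewrite eaddE escaleE scalerDl scalerA.
Qed.

HB.instance Definition _ :=
  GRing.isLinear.Build rat (exterior I) B _ elift elift_is_linear.

Lemma elift_base S : elift (ebase S) = \prod_(i in S) f i.
Proof.
rewrite /elift (bigD1 S) //= [X in _ + X]big1 => [|T /negPf neT].
  by rewrite ebaseE eqxx scale1r addr0.
by rewrite ebaseE neT scale0r.
Qed.

(** [f g] anticommutes past the other factors until it meets its own copy, where the square
    vanishes. *)
Lemma prod_absorb (r : seq I) T g : g \in T -> g \in r ->
  f g * \prod_(i <- r | i \in T) f i = 0.
Proof.
move=> gT; elim: r => // a r IHr; rewrite inE big_cons.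
have [<- _|neq /= gr] := eqVneq g a; first by rewrite gT mulrA f_sqr mul0r.
by case: ifP => _; rewrite ?IHr // mulrA f_anti mulNr -mulrA IHr // mulr0 oppr0.
Qed.

(** [f g] moves right to its place in [r], and each factor from [T] that it passes contributes a
    sign. *)
Lemma prod_insert (r : seq I) T g : g \notin T -> g \in r -> uniq r ->
  f g * \prod_(i <- r | i \in T) f i =
  (-1) ^+ count [in T] (take (index g r) r) *: \prod_(i <- r | i \in g |: T) f i.
Proof.
move=> gT; elim: r => // a r IHr; rewrite inE /= !big_cons eq_sym.
have [-> _ /andP[gr _]|neq /= gr /andP[ar r_uniq]] := eqVneq a g.
  rewrite /= scale1r setU11 (negPf gT); congr (_ * _).
  rewrite big_seq_cond [RHS]big_seq_cond; apply: eq_bigl => i.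
  by rewrite !inE; case: eqP => // ->; rewrite (negPf gr).
rewrite in_setU1 (negPf neq) /=.
case: (boolP (a \in T)) => aT; last by rewrite add0n IHr.
by rewrite mulrA f_anti mulNr -mulrA IHr // exprD expr1 mulN1r scaleNr scalerAr.
Qed.

(* Signs are counted by [enum_rank] in [einv], by position in [index_enum] in big
   products. *)
Lemma count_take_index (p : pred I) g :
  count p (take (index g (index_enum I)) (index_enum I)) =
  #|[set i | p i & (enum_rank i < enum_rank g)%N]|.
Proof.
have rankE i : (enum_rank i : nat) = index i (index_enum I).
  rewrite /enum_rank enum_rank_in.unlock insubdK.
    by rewrite enumT [index_enum I]unlock.
  by rewrite -topredE /= cardE index_mem mem_enum.
rewrite -size_filter cardE; apply: perm_size.
apply: uniq_perm; rewrite ?enum_uniq ?filter_uniq ?take_uniq ?index_enum_uniq //.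
move=> i; rewrite mem_enum inE mem_filter !rankE; case: (p i) => //=.
by rewrite in_take ?mem_index_enum.
Qed.

Lemma liftM_gen g T : f g * \prod_(i in T) f i = elift (ebase_mul [set g] T).
Proof.
rewrite /ebase_mul; case: ifPn => [|dgT]; last first.
  rewrite linear0 prod_absorb ?mem_index_enum //.
  by apply: contraNT dgT; rewrite disjoints1.
rewrite disjoints1 => gT.
rewrite prod_insert ?mem_index_enum ?index_enum_uniq // linearZ /= elift_base.
rewrite count_take_index; congr ((-1) ^+ _ *: _).
rewrite -(card_imset _ (_ : injective (pair g))) => [|i j []//].
apply: eq_card => -[a b]; rewrite !inE /=; apply/imsetP/idP => [[i]|].
  by rewrite inE => /andP[iT lt_ig] [-> ->]; rewrite eqxx iT.
by case/andP=> /andP[/eqP-> bT] lt_bg; exists b; rewrite // inE; apply/andP.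
Qed.

Lemma elift1 : elift 1 = 1.
Proof. by rewrite elift_base big_pred0 // => i; rewrite inE. Qed.

(** Splitting off the least element creates no inversion, hence no sign. *)
Lemma ebase_split_min S : S != set0 ->
  exists2 g, g \in S & ebase S = ebase [set g] * ebase (S :\ g).
Proof.
case/set0Pn => g0 g0S.
case: (arg_minnP (fun i => enum_rank i : nat) g0S) => g gS gmin.
exists g => //; rewrite ebaseM /ebase_mul disjoints1 !inE eqxx /= setD1K //.
rewrite (_ : einv _ _ = 0%N) ?scale1r //; apply/eqP; rewrite cards_eq0.
apply/eqP/setP => -[a b]; rewrite !inE /=; apply/negP.
by case/andP=> /andP[/eqP-> /andP[_ /gmin]]; rewrite leqNgt => /negPf->.
Qed.

(** Linearity reduces both arguments to monomials; the left one is then peeled off generator by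
    generator, where [liftM_gen] applies. *)
Lemma eliftM x y : elift (x * y) = elift x * elift y.
Proof.
have genM g z : elift (ebase [set g] * z) = f g * elift z.
  rewrite (ebase_expand z) mulr_sumr !linear_sum mulr_sumr; apply: eq_bigr => T _.
  by rewrite -scalerAr ebaseM !linearZ /= -liftM_gen elift_base scalerAr.
rewrite (ebase_expand x) mulr_suml !linear_sum mulr_suml; apply: eq_bigr => S _.
rewrite -scalerAl !linearZ /= -scalerAl; congr (_ *: _).
have [m] := ubnP #|S|; elim: m S => // m IHm S leSm.
have [->|/ebase_split_min[g gS ->]] := eqVneq S set0.
  by rewrite -[ebase set0]/(1 : exterior I) elift1 !mul1r.
rewrite -mulrA !genM IHm ?mulrA //.
by rewrite (cardsD1 g) gS in leSm.
Qed.

End UniversalProperty.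

(** * Coefficients and supports of products *)

Section Coefficients.
Variable I : finType.
Implicit Types (x y : exterior I) (S T U A : {set I}) (u v : I).

Lemma coef_ebaseMr x v U :
  (x * ebase [set v]) U =
  if v \in U then (-1) ^+ einv (U :\ v) [set v] * x (U :\ v) else 0.
Proof.
have mE S : (ebase_mul S [set v]) U =
    if (v \in U) && (S == U :\ v) then (-1) ^+ einv S [set v] else 0.
  rewrite /ebase_mul disjoint_sym disjoints1.
  have [vS|vS] /= := boolP (v \in S).
    by rewrite ffunE; case: eqP => [SU|]; rewrite ?andbF // andbT SU !inE eqxx in vS *.
  rewrite escaleE ebaseE; case: (eqVneq U (S :|: [set v])) => [->|neU].
    rewrite mulr1 !inE eqxx orbT /= setUC setU1K // eqxx //.
  rewrite mulr0; case: ifP => // /andP[vU /eqP SU].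
  by rewrite SU setUC setD1K ?eqxx in neU.
rewrite {1}(ebase_expand x) mulr_suml esumE (bigD1 (U :\ v)) //=.
rewrite big1 ?addr0 => [|S neS].
  rewrite -scalerAl escaleE ebaseM mE eqxx andbT mulrC; case: ifP => // _.
  by rewrite mul0r.
by rewrite -scalerAl escaleE ebaseM mE (negPf neS) andbF mulr0.
Qed.

Lemma emul_coef_neq0 x y U : (x * y) U != 0 ->
  exists S T, [/\ [disjoint S & T], U = S :|: T, x S != 0 & y T != 0].
Proof.
rewrite emul_coef => xyU.
have [/existsP[S /existsP[T /and4P[dST /eqP-> xS yT]]]|/existsPn no] := boolP
    [exists S : {set I}, exists T : {set I},
      [&& [disjoint S & T], U == S :|: T, x S != 0 & y T != 0]].
  by exists S, T.
case/eqP: xyU; rewrite big1 // => S _; rewrite big1 // => T _.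
case: ifP => // /andP[dST /eqP STU].
move/existsPn/(_ T): (no S); rewrite dST STU eqxx /= negb_and !negbK.
by case/orP=> /eqP->; rewrite ?mulr0 ?mul0r.
Qed.

(** Degrees add and supports unite in a product; on images of monomials this controls the degree and
    the vertices that occur. *)
Lemma coef_prod_neq0 (J : eqType) (r : seq J) (P : pred J) (F : J -> exterior I) A :
  (forall j, j \in r -> P j -> forall S, F j S != 0 -> #|S| = 1%N /\ S \subset A) ->
  forall S, (\prod_(j <- r | P j) F j) S != 0 -> #|S| = count P r /\ S \subset A.
Proof.
elim: r => [|j r IHr] FA S.
  rewrite big_nil -[1]/(ebase set0) ebaseE; case: (eqVneq S set0) => [-> _|_ /eqP//].
  by rewrite cards0 sub0set.
rewrite big_cons /=; have IH := IHr (fun i ir => FA i (mem_behead (s := j :: r) ir)).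
case: ifP => [Pj|_] /=; last exact: IH.
case/emul_coef_neq0 => S1 [S2] [d12 -> /FA FS1 /IH[cS2 sS2]].
have [cS1 sS1] := FS1 (mem_head _ _) Pj.
by rewrite cardsU disjoint_setI0 // cards0 subn0 cS1 cS2 subUset sS1.
Qed.

Lemma xgen_sqr u : ebase [set u] * ebase [set u] = 0 :> exterior I.
Proof. by rewrite ebaseM /ebase_mul disjoints1 inE eqxx. Qed.

Lemma einv11 u v : u != v -> (einv [set u] [set v] + einv [set v] [set u] = 1)%N.
Proof.
have E a b : einv [set a] [set b] = (enum_rank b < enum_rank a)%N.
  rewrite /einv; have [ltba|/negPf ltba] /= := boolP (enum_rank b < enum_rank a)%N.
    rewrite -[RHS](cards1 (a, b)); apply: eq_card => -[p q]; rewrite !inE /= xpair_eqE.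
    by case: eqP => //= ->; case: eqP => //= ->; rewrite ltba.
  apply: eq_card0 => -[p q]; rewrite !inE /=.
  by case: eqP => //= ->; case: eqP => //= ->; rewrite ltba.
move=> neuv; rewrite !E; case: ltngtP => // /val_inj/enum_rank_inj/eqP.
by rewrite eq_sym (negPf neuv).
Qed.

Lemma xgen_anti u v :
  ebase [set u] * ebase [set v] = - (ebase [set v] * ebase [set u]) :> exterior I.
Proof.
have [->|neuv] := eqVneq u v; first by rewrite xgen_sqr oppr0.
rewrite !ebaseM /ebase_mul !disjoints1 !inE neuv eq_sym neuv setUC -scaleNr.
congr (_ *: _); have := einv11 neuv.
by case: (einv _ _) => [|[|//]]; case: (einv _ _) => [|[|//]] //= _; rewrite opprK.
Qed.

End Coefficients.

(** * Ends and directions of edges, and the characters attached to ordered blocks *)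

Section OrderCharacters.
Variable n : nat.
Implicit Types (i j k u v : 'I_n) (g h : gen n) (E F : {set gen n}).

(** An edge is recorded by its two ends sorted by size and by its direction, the data on which
    reducedness depends. *)
Definition hi g : 'I_n := if ((val g).1 < (val g).2)%N then (val g).2 else (val g).1.
Definition lo g : 'I_n := if ((val g).1 < (val g).2)%N then (val g).1 else (val g).2.
Definition down g : bool := ((val g).2 < (val g).1)%N.

Lemma lo_lt_hi g : (lo g < hi g)%N.
Proof.
rewrite /lo /hi; case: (ltngtP (val g).1 (val g).2) => // /ord_inj eqg.
by have := svalP g; rewrite eqg eqxx.
Qed.

Lemma down_val g : val g = if down g then (hi g, lo g) else (lo g, hi g).
Proof.
rewrite /lo /hi /down; case: (ltngtP (val g).1 (val g).2) => [_|_|/ord_inj eqg].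
- by case: (val g).
- by case: (val g).
- by case: (val g) eqg => u v /= ->.
Qed.

Lemma gen_eq g h : hi g = hi h -> lo g = lo h -> down g = down h -> g = h.
Proof. by move=> e1 e2 e3; apply: val_inj; rewrite !down_val e1 e2 e3. Qed.

Variables (b : 'I_n -> 'I_n) (r : 'I_n -> nat).

Definition xdiff u v : exterior 'I_n := ebase [set v] - ebase [set u].

Lemma anticommBl (x y z : exterior 'I_n) :
  x * z = - (z * x) -> y * z = - (z * y) -> (x - y) * z = - (z * (x - y)).
Proof. by move=> xz yz; rewrite mulrBl mulrBr xz yz opprD. Qed.

Lemma xdiff_anti i j k l : xdiff i j * xdiff k l = - (xdiff k l * xdiff i j).
Proof.
have anti1 u v w : xdiff u v * ebase [set w] = - (ebase [set w] * xdiff u v).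
  by apply: anticommBl; apply: xgen_anti.
by apply: anticommBl; rewrite anti1 opprK.
Qed.

Lemma xdiff_sqr i j : xdiff i j * xdiff i j = 0.
Proof.
by rewrite /xdiff mulrBl !mulrBr !xgen_sqr sub0r subr0 (xgen_anti i j) opprK addNr.
Qed.

Lemma xdiffD i j k : xdiff i j + xdiff j k = xdiff i k.
Proof. by rewrite /xdiff addrC subrKA. Qed.

(** Defined on all pairs of vertices, equal ones included, to match [rgen], which is zero on the
    diagonal. *)
Definition pair_char i j : exterior 'I_n :=
  if (b i == b j) && (r i < r j)%N then xdiff i j else 0.

Definition order_char g := pair_char (val g).1 (val g).2.

Lemma pair_char_anti i j k l :
  pair_char i j * pair_char k l = - (pair_char k l * pair_char i j).
Proof.
rewrite /pair_char; case: ifP => _; case: ifP => _; rewrite ?(mul0r, mulr0, oppr0) //.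
exact: xdiff_anti.
Qed.

Lemma pair_char_sqr i j : pair_char i j * pair_char i j = 0.
Proof.
by rewrite /pair_char; case: ifP => _; rewrite ?mul0r // xdiff_sqr.
Qed.

Lemma order_char_anti g h : order_char g * order_char h = - (order_char h * order_char g).
Proof. exact: pair_char_anti. Qed.

Lemma order_char_sqr g : order_char g * order_char g = 0.
Proof. exact: pair_char_sqr. Qed.

Lemma elift_rgen i j : elift order_char (rgen i j) = pair_char i j.
Proof.
rewrite /rgen; case: insubP => [g _ gij|].
  by rewrite elift_base big_set1 /order_char gij.
rewrite negbK => /eqP/= ->; rewrite /pair_char ltnn andbF; exact: linear0.
Qed.

Hypothesis r_inj : injective r.

(** Expand [xdiff i k] as [xdiff i j + xdiff j k]; the repeated factor squares to zero. *)
Lemma xdiff_path i j k : xdiff i j * xdiff j k = xdiff i j * xdiff i k.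
Proof. by rewrite -(xdiffD i j k) [RHS]mulrDr xdiff_sqr add0r. Qed.

Lemma xdiff_path' i j k : xdiff i j * xdiff j k = xdiff i k * xdiff j k.
Proof. by rewrite -(xdiffD i j k) [RHS]mulrDl xdiff_sqr addr0. Qed.

(** All three products vanish unless the vertices share a block and [i] precedes both others. In
    that case the order of [j] and [k] selects one product on the right, and [xdiff_path] matches it
    with the left. *)
Lemma pair_char_rel1 i j k : j != k ->
  pair_char i j * pair_char i k =
  pair_char i j * pair_char j k - pair_char i k * pair_char k j.
Proof.
move=> nejk; have nrjk : r j != r k by rewrite (inj_eq r_inj).
rewrite /pair_char [b k == b j]eq_sym.
case: (eqVneq (b i) (b j)) => [<-|neij] /=; last first.
  case: (eqVneq (b i) (b k)) => [<-|neik] /=; last by rewrite !mul0r subrr.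
  by rewrite [b j == _]eq_sym (negPf neij) /= !(mulr0, mul0r) subrr.
case: (eqVneq (b i) (b k)) => [eik|neik] /=; last by rewrite mulr0 mul0r subrr.
case: (ltnP (r i) (r j)) => lij; case: (ltnP (r i) (r k)) => lik;
  case: (ltngtP (r j) (r k)) nrjk => //= ljk _;
  rewrite ?(mul0r, mulr0, subr0, sub0r, oppr0) // ?xdiff_path //; try lia.
by rewrite xdiff_anti.
Qed.

(** The mirror image of [pair_char_rel1]: now [k] has to come after both [i] and [j]. *)
Lemma pair_char_rel2 i j k : i != j ->
  pair_char i k * pair_char j k =
  pair_char i j * pair_char j k - pair_char j i * pair_char i k.
Proof.
move=> neij; have nrij : r i != r j by rewrite (inj_eq r_inj).
rewrite /pair_char [b j == b i]eq_sym.
case: (eqVneq (b i) (b j)) => [<-|neij'] /=; last first.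
  case: (eqVneq (b i) (b k)) => [<-|neik] /=; last by rewrite !mul0r subrr.
  by rewrite [b j == _]eq_sym (negPf neij') /= !(mulr0, mul0r) subrr.
case: (eqVneq (b i) (b k)) => [eik|neik] /=; last by rewrite !mulr0 subrr.
case: (ltnP (r i) (r k)) => lik; case: (ltnP (r j) (r k)) => ljk;
  case: (ltngtP (r i) (r j)) nrij => //= lij _;
  rewrite ?(mul0r, mulr0, subr0, sub0r, oppr0) // ?xdiff_path' //; try lia.
by rewrite xdiff_anti.
Qed.

Lemma pair_char_opposite i j : pair_char i j * pair_char j i = 0.
Proof.
by rewrite /pair_char; case: (ltngtP (r i) (r j)); rewrite ?(andbF, mul0r, mulr0).
Qed.

Lemma elift_ideal (x : ext n) : in_ideal x -> elift order_char x = 0.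
Proof.
have M := eliftM order_char_sqr order_char_anti.
case=> s [rel_s ->]; rewrite linear_sum big_seq big1 // => -[[y rho] z] /rel_s /= rel.
rewrite !wedgeE !M; suff -> : elift order_char rho = 0 by rewrite mulr0 mul0r.
case: rel => [[i [j [k [[neij neik nejk] [->|->]]]]]|[i [j [neij ->]]]];
  rewrite !wedgeE ?linearB /= !M !elift_rgen.
- by rewrite -opprD -pair_char_rel1 // subrr.
- by rewrite -opprD -pair_char_rel2 // subrr.
- exact: pair_char_opposite.
Qed.

End OrderCharacters.

(** * Linear independence of the reduced monomials *)

Section Independence.
Variable n : nat.
Implicit Types (u v k : 'I_n) (g h : gen n) (E F : {set gen n}) (m p : nat).

Definition reduced E : bool :=
  [forall g in E, forall h in E,
     ((hi g == hi h) ==> (g == h)) && (down g ==> (lo g != hi h))].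

Lemma reducedP E :
  reflect ({in E &, injective (@hi n)} /\
           {in E &, forall g h, down g -> lo g != hi h}) (reduced E).
Proof.
apply: (iffP forall_inP) => [nE|[inj_hi no_down] g gE].
  split=> g h gE hE; have /forall_inP/(_ h hE)/andP[/implyP i1 /implyP i2] := nE g gE.
    by move/eqP/i1/eqP.
  exact: i2.
apply/forall_inP => h hE; apply/andP; split; apply/implyP.
  by move/eqP/(inj_hi _ _ gE hE)->.
exact: no_down.
Qed.

Lemma reducedS E F : E \subset F -> reduced F -> reduced E.
Proof.
move=> /subsetP sEF /reducedP[inj_hi no_down]; apply/reducedP.
by split=> g h /sEF gF /sEF hF; [apply: inj_hi|apply: no_down].
Qed.

Definition below m E : bool := [forall g in E, (hi g < m)%N].

Lemma belowP m E : reflect (forall g, g \in E -> (hi g < m)%N) (below m E).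
Proof. exact: (iffP forall_inP). Qed.

(* Blocks are encoded by [b], which maps a vertex to the minimum of its block; all
   vertices from [m] on are singleton blocks. *)
Definition good_order m (b : 'I_n -> 'I_n) (r : 'I_n -> nat) :=
  [/\ forall v, b (b v) = b v, forall v, (b v <= v)%N,
      forall v, (m <= v)%N -> b v = v & injective r].

Definition nonroots (b : 'I_n -> 'I_n) : {set 'I_n} := [set v | b v != v].

Definition order_coef b r (x : exterior (gen n)) : rat :=
  elift (order_char b r) x (nonroots b).

Lemma order_coef_linear b r : linear (order_coef b r : _ -> rat^o).
Proof. by move=> a x y; rewrite /order_coef linearP eaddE escaleE. Qed.

HB.instance Definition _ b r :=
  GRing.isLinear.Build rat (exterior (gen n)) rat^o _ (order_coef b r)
    (order_coef_linear b r).

Lemma order_char_neq0 b r g :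
  order_char b r g != 0 -> b (hi g) = b (lo g).
Proof.
rewrite /order_char /pair_char down_val.
by case: ifP; rewrite ?eqxx //; case: (down g) => /= /andP[/eqP->].
Qed.

Lemma order_char_coef b r g S : order_char b r g S != 0 ->
  #|S| = 1%N /\ S \subset [set hi g; lo g].
Proof.
rewrite /order_char /pair_char down_val; case: ifP; last by rewrite ffunE eqxx.
move=> _; rewrite /xdiff !ffunE.
case: (eqVneq S [set _]) => [->|_].
  by rewrite cards1 sub1set !inE; case: (down g); rewrite /= eqxx ?orbT.
case: (eqVneq S [set _]) => [->|_]; last by rewrite subrr eqxx.
by rewrite cards1 sub1set !inE; case: (down g); rewrite /= eqxx ?orbT.
Qed.

Lemma elift_coef_card b r E S :
  elift (order_char b r) (ebase E) S != 0 -> #|S| = #|E|.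
Proof.
rewrite elift_base => /(coef_prod_neq0 (A := setT)) [] => [g _ _ T|-> _].
  by case/order_char_coef => ->; rewrite subsetT.
rewrite cardE -size_filter; apply: perm_size; apply: uniq_perm.
- by rewrite filter_uniq ?index_enum_uniq.
- exact: enum_uniq.
- by move=> g; rewrite [RHS]mem_enum mem_filter mem_index_enum andbT.
Qed.

Lemma elift_coef_below b r m E S : below m E ->
  elift (order_char b r) (ebase E) S != 0 -> forall v, v \in S -> (v < m)%N.
Proof.
move=> /belowP ltEm.
rewrite elift_base => /(coef_prod_neq0 (A := [set v : 'I_n | (v < m)%N])) [].
  move=> g _ gE T /order_char_coef[-> /subset_trans->] //.
  apply/subsetP => v; rewrite !inE => /orP[]/eqP->; first exact: ltEm.
  exact: ltn_trans (lo_lt_hi g) (ltEm g gE).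
by move=> _ /subsetP sS v /sS; rewrite inE.
Qed.

(** Bring [g] to the front of the monomial: an edge between different blocks would make its factor,
    hence the whole image, zero. *)
Lemma order_coef_factor b r E g :
  order_coef b r (ebase E) != 0 -> g \in E -> b (hi g) = b (lo g).
Proof.
move=> LE gE; apply: (order_char_neq0 (r := r)); apply: contraNneq LE => fg0.
have fS := order_char_sqr b r; have fA := order_char_anti b r.
rewrite (ebase_setD1 gE).
rewrite linearZ /= /order_coef (eliftM fS fA) elift_base big_set1 fg0 mul0r ffunE.
by rewrite scaler0.
Qed.

(* The upper ends of the edges of [E] are distinct non-minimal vertices of their
   blocks, and degrees force them to be all of these. *)
Lemma reduced_nonroot m b r E v : good_order m b r -> reduced E ->
  order_coef b r (ebase E) != 0 -> v \in nonroots b -> exists2 g, g \in E & hi g = v.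
Proof.
case=> bb bv _ _ /reducedP[inj_hi _] LE vb.
suff: nonroots b = @hi n @: E by move=> bE; move: vb; rewrite bE => /imsetP[g gE ->]; exists g.
apply/esym/eqP; rewrite eqEcard card_in_imset // (elift_coef_card LE) leqnn andbT.
apply/subsetP => _ /imsetP[g gE ->]; rewrite inE (order_coef_factor LE gE).
by apply: contraTneq (bv (lo g)) => ->; rewrite -ltnNge lo_lt_hi.
Qed.


(* Vertex [k] enters the block with minimum [B], in front of the vertices of rank
   at least [p]. *)
Definition insert_block (b : 'I_n -> 'I_n) k B v := if v == k then B else b v.

(** Doubling leaves the even ranks free, so [k] fits in without a tie. *)
Definition insert_rank (r : 'I_n -> nat) k p v :=
  if v == k then p.*2 else (r v).*2.+1.

(** The scalar in [insert_char]: an edge between [k] and [lo g] becomes this multiple of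
    [xdiff (lo g) k]. A downward edge gets a minus sign because it survives only when [k] comes
    first. *)
Definition insert_sign (b : 'I_n -> 'I_n) (r : 'I_n -> nat) B p g : rat :=
  if b (lo g) == B then
    if down g then - (p <= r (lo g))%N%:R else (r (lo g) < p)%N%:R
  else 0.

Lemma insert_block_id b k B v : v != k -> insert_block b k B v = b v.
Proof. by rewrite /insert_block => /negPf->. Qed.

Lemma insert_rank_id r k p v : v != k -> insert_rank r k p v = (r v).*2.+1.
Proof. by rewrite /insert_rank => /negPf->. Qed.

Section Insertion.
Variables (k B : 'I_n) (b : 'I_n -> 'I_n) (r : 'I_n -> nat) (p : nat).
Hypothesis good_br : good_order k b r.
Hypothesis B_root : b B = B.
Hypothesis ltBk : (B < k)%N.

Let b' := insert_block b k B.
Let r' := insert_rank r k p.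

Lemma insert_good : good_order k.+1 b' r'.
Proof.
have [bb bv bfix r_inj] := good_br.
split.
- move=> v; have [->|nevk] := eqVneq v k.
    have -> : b' k = B by rewrite /b' /insert_block eqxx.
    by rewrite /b' insert_block_id // -val_eqE neq_ltn ltBk.
  rewrite /b' (insert_block_id _ _ nevk) insert_block_id ?bb //.
  apply: contraNneq nevk => bvk.
  have [ltvk|lekv] := ltnP v k; last by rewrite -bvk bfix.
  by have := bv v; rewrite bvk leqNgt ltvk.
- move=> v; rewrite /b' /insert_block; case: (eqVneq v k) => [->|_] //; exact: ltnW.
- move=> v ltkv; rewrite /b' insert_block_id; first exact/bfix/ltnW.
  by rewrite -val_eqE neq_ltn ltkv orbT.
move=> u v; rewrite /r' /insert_rank.
case: (eqVneq u k) => [->|_]; case: (eqVneq v k) => [->|_] //; try lia.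
by move=> e; apply: r_inj; lia.
Qed.

Lemma insert_nonroots : nonroots b' = k |: nonroots b.
Proof.
apply/setP => v; rewrite !inE /b' /insert_block; case: (eqVneq v k) => //= ->.
by rewrite -val_eqE neq_ltn ltBk.
Qed.

Lemma root_notin_nonroots : k \notin nonroots b.
Proof. by have [_ _ bfix _] := good_br; rewrite inE negbK bfix. Qed.

Lemma insert_char g : hi g = k ->
  order_char b' r' g = insert_sign b r B p g *: xdiff (lo g) k.
Proof.
move=> gk; have neuk : lo g != k by rewrite -gk -val_eqE neq_ltn lo_lt_hi.
rewrite /order_char /insert_sign down_val gk.
have bk : b' k = B by rewrite /b' /insert_block eqxx.
have rk : r' k = p.*2 by rewrite /r' /insert_rank eqxx.
case: (down g); rewrite /pair_char /= bk rk {}/b' {}/r' insert_block_id // insert_rank_id //.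
  rewrite eq_sym; case: eqP => _; rewrite ?scale0r //=.
  have -> : (p.*2 < (r (lo g)).*2.+1)%N = (p <= r (lo g))%N by lia.
  by case: (p <= _)%N; rewrite ?scaleN1r ?oppr0 ?scale0r // /xdiff opprB.
case: eqP => _; rewrite ?scale0r //=.
have -> : ((r (lo g)).*2.+1 < p.*2)%N = (r (lo g) < p)%N by lia.
by case: (_ < p)%N; rewrite ?scale1r ?scale0r.
Qed.

(** Edges of [E] do not touch [k], and the ranks of the other vertices keep their order. *)
Lemma insert_elift E : below k E ->
  elift (order_char b' r') (ebase E) = elift (order_char b r) (ebase E).
Proof.
move=> /belowP ltEk; rewrite !elift_base; apply: eq_bigr => g /ltEk lt_gk.
have neh : hi g != k by rewrite -val_eqE neq_ltn lt_gk.
have nel : lo g != k.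
  by rewrite -val_eqE neq_ltn (ltn_trans (lo_lt_hi g) lt_gk).
rewrite /order_char /pair_char down_val /b' /r'.
by case: (down g); rewrite /= !insert_block_id // !insert_rank_id // ltnS ltn_double.
Qed.

(** The wanted coefficient involves [k], which is absent from the image of [E]; only the summand of
    [xdiff (lo g) k] at [k] can supply it. *)
Lemma insert_coef E g : below k E -> hi g = k ->
  order_coef b' r' (ebase E * ebase [set g]) =
  (-1) ^+ einv (nonroots b) [set k] *
    (insert_sign b r B p g * order_coef b r (ebase E)).
Proof.
move=> ltEk gk; rewrite /order_coef.
rewrite (eliftM (order_char_sqr b' r') (order_char_anti b' r')) insert_elift //.
rewrite (elift_base _ [set g]) big_set1 insert_char // -scalerAr escaleE.
rewrite insert_nonroots mulrBr ffunE [(- _ : exterior 'I_n) _]ffunE !coef_ebaseMr.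
rewrite setU11 setU1K ?root_notin_nonroots // [in X in _ + X]fun_if.
rewrite mulrCA; congr (_ * _).
suff -> : elift (order_char b r) (ebase E) ((k |: nonroots b) :\ lo g) = 0.
  by rewrite mulr0 oppr0 if_same addr0.
apply/eqP; apply: contraFT (ltnn k) => /(elift_coef_below ltEk) -> //.
by rewrite !inE eqxx -gk andbT -val_eqE neq_ltn lo_lt_hi orbT.
Qed.

End Insertion.

(** Injectivity of [hi] leaves at most one edge at [k] in a set with nonzero coefficient, and sets
    without one are killed by [l]. The sign comes from writing that edge as the last factor. *)
Lemma sum_top_edge k (c : {set gen n} -> rat) (l : {linear exterior (gen n) -> rat^o}) :
  (forall E, c E != 0 -> reduced E && below k.+1 E) ->
  (forall E, c E != 0 -> below k E -> l (ebase E) = 0) ->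
  \sum_E c E * l (ebase E) =
  \sum_(g | hi g == k) \sum_(E | below k E)
     (-1) ^+ einv E [set g] * c (g |: E) * l (ebase E * ebase [set g]).
Proof.
move=> c_supp l0.
(* The inner sum counts the edges of [E] at [k], exactly one for a set that contributes. *)
transitivity (\sum_(E : {set gen n}) \sum_(g | hi g == k) (g \in E)%:R * (c E * l (ebase E))).
  apply: eq_bigr => E _.
  have [->|/[dup] cE /c_supp/andP[/reducedP[inj_hi _] /belowP ltE]] := eqVneq (c E) 0.
    by rewrite mul0r big1 // => g _; rewrite mulr0.
  have [/existsP[g /andP[gE /eqP gk]]|/existsPn no] :=
      boolP [exists g, (g \in E) && (hi g == k)].
    rewrite (bigD1 g) ?gk //= gE mul1r big1 ?addr0 // => h /andP[/eqP hk neh].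
    case: (boolP (h \in E)) => hE; rewrite ?mul0r //.
    by rewrite (inj_hi h g hE gE) ?eqxx ?hk ?gk in neh.
  rewrite l0 //; first by rewrite mulr0 big1 // => g _; rewrite mulr0.
  apply/belowP => g gE; have := ltE g gE; rewrite ltnS leq_eqVlt.
  by have := no g; rewrite gE /= -val_eqE => /negPf->.
rewrite exchange_big /=; apply: eq_bigr => g /eqP gk.
transitivity (\sum_(E : {set gen n} | g \in E) c E * l (ebase E)).
  rewrite [RHS]big_mkcond; apply: eq_bigr => E _.
  by case: ifP; rewrite ?mul1r ?mul0r.
rewrite (reindex_onto (fun E => g |: E) (fun E => E :\ g)) => [|E gE]; last exact: setD1K.
rewrite (bigID (below k)) /= [X in _ + X]big1 ?addr0.
  apply: eq_big => [E|E].
    rewrite setU11 /=; case: (boolP (below k E)) => [/belowP ltE|_]; last by rewrite andbF.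
    rewrite andbT; apply/eqP/setU1K; apply/negP => /ltE; by rewrite gk ltnn.
  move=> /andP[/andP[_ /eqP gE] _].
  have {}gE : g \notin E by rewrite -gE !inE eqxx.
  (* The reordering sign appears in the coefficient and again in the product, and squares to one. *)
  rewrite ebaseM /ebase_mul disjoint_sym disjoints1 gE linearZ setUC.
  set s := (-1) ^+ _; set y := l _.
  change (c (E :|: [set g]) * y = s * c (E :|: [set g]) * (s * y)).
  by rewrite mulrACA -expr2 sqrr_sign mul1r.
(* A second edge at [k] besides [g] would contradict reducedness, so these coefficients vanish. *)
move=> E /andP[/andP[_ /eqP gE]]; have [->|/c_supp/andP[]] := eqVneq (c (g |: E)) 0.
  by rewrite mul0r.
have {}gE : g \notin E by rewrite -gE !inE eqxx.
move=> /reducedP[inj_hi _] /belowP ltE /negP[]; apply/belowP => h hE.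
have := ltE h; rewrite in_setU1 hE orbT ltnS leq_eqVlt => /(_ isT) /predU1P[hk|//].
case/negP: gE; rewrite -(inj_hi h g) ?setU11 ?inE ?hE ?orbT //.
by apply: ord_inj; rewrite gk.
Qed.

(** Induction on the number of available vertices. With [k] the last one, the coefficients of sets
    without an edge at [k] vanish first, then those with a downward edge at [k], then the others;
    each time the induction hypothesis is applied to a family supported below [k]. *)
Lemma reduced_indep m (c : {set gen n} -> rat) : (m <= n)%N ->
  (forall E, c E != 0 -> reduced E && below m E) ->
  (forall b r, good_order m b r -> \sum_E c E * order_coef b r (ebase E) = 0) ->
  forall E, c E = 0.
Proof.
elim: m c => [|m IHm] c len c_supp c_kill E.
  have E0 F : c F != 0 -> F = set0.
    move=> /c_supp/andP[_ /belowP noF].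
    by apply/eqP; rewrite -subset0; apply/subsetP => g /noF.
  have [->//|/E0 ->] := eqVneq (c E) 0.
  (* All blocks are singletons here, and the empty monomial has order coefficient one. *)
  have := c_kill id (fun v => v : nat) _; rewrite (bigD1 set0) //= big1 => [|F neF].
    rewrite addr0 /order_coef -[ebase set0]/(1 : exterior _) elift1.
    rewrite (_ : nonroots id = set0); last by apply/setP => v; rewrite !inE eqxx.
    rewrite ebaseE eqxx mulr1; apply; split=> //; exact: ord_inj.
  have [->|/E0 eF] := eqVneq (c F) 0; first by rewrite mul0r.
  by rewrite eF eqxx in neF.
pose k := Ordinal len.
(* Blocks that are singletons from [m] on isolate [k], so the order coefficient of any monomial with
   an edge at [k] is zero. *)
have c_top F : below m F -> c F = 0.
  pose c' F := if below m F then c F else 0.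
  move=> ltF; suff : c' F = 0 by rewrite /c' ltF.
  apply: IHm; first exact: ltnW.
    by move=> G; rewrite /c'; case: ifP => [ltG /c_supp/andP[->]//|]; rewrite eqxx.
  move=> b r good_br; have [bb bv bfix r_inj] := good_br.
  have good' : good_order m.+1 b r by split=> // v /ltnW/bfix.
  rewrite -[RHS](c_kill b r good').
  apply: eq_bigr => G _; rewrite /c'; case: ifP => // /negbT ltG; rewrite mul0r.
  have [->|/c_supp/andP[_ /belowP ltG']] := eqVneq (c G) 0; first by rewrite mul0r.
  have [g gG lemg] : exists2 g, g \in G & (m <= hi g)%N.
    by case/forall_inPn: ltG => g gG; rewrite -leqNgt; exists g.
  have [->|/order_coef_factor/(_ gG) eqb] := eqVneq (order_coef b r (ebase G)) 0.
    by rewrite mulr0.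
  have := bv (lo g); rewrite -eqb bfix // leqNgt lo_lt_hi //.
(* [d g] collects the coefficients of the sets whose edge at [k] is [g], with the sign of moving [g]
   to the end. *)
pose d g F := (-1) ^+ einv F [set g] * c (g |: F).
have d_supp g F : d g F != 0 -> hi g = k -> below m F -> reduced F /\
    (down g -> forall h, h \in F -> lo g != hi h).
  rewrite /d mulf_eq0 signr_eq0 /= => /c_supp/andP[nF _] gk ltF.
  split; first exact: reducedS (subsetUr _ _) nF.
  move=> dg h hF; have /reducedP[_ no_down] := nF.
  by apply: no_down dg; rewrite !inE ?eqxx ?hF ?orbT.
(* Every place [(B, p)] for [k] yields one linear condition on the [d g], after cancelling a sign
   common to all terms. *)
have S b r (B : 'I_n) p : good_order m b r -> b B = B -> (B < m)%N ->
    \sum_(g | hi g == k) \sum_(F | below m F)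
       d g F * (insert_sign b r B p g * order_coef b r (ebase F)) = 0.
  move=> good_br bB ltB.
  have good' := @insert_good k B b r p good_br bB ltB.
  have := c_kill _ _ good'; rewrite (sum_top_edge (k := k)) //; last first.
    by move=> F cF /c_top cF0; rewrite cF0 eqxx in cF.
  move=> sum0; have sign_neq0 : (-1) ^+ einv (nonroots b) [set k] != 0 :> rat by rewrite signr_eq0.
  apply: (mulfI sign_neq0).
  rewrite mulr0 -[RHS]sum0 mulr_sumr; apply: eq_bigr => g /eqP gk.
  rewrite mulr_sumr; apply: eq_bigr => F ltF.
  by rewrite /= insert_coef // mulrCA.
(* If the target of a downward edge [g] is not a root, [reduced_nonroot] makes it the upper end of
   an edge of [F], against the reducedness of [g |: F]. *)
have dL0 b r g F : good_order m b r -> below m F -> hi g = k -> down g ->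
    lo g \in nonroots b -> d g F * order_coef b r (ebase F) = 0.
  move=> good_br ltF gk dg bg.
  have [->|dF] := eqVneq (d g F) 0; first by rewrite mul0r.
  have [->|LF] := eqVneq (order_coef b r (ebase F)) 0; first by rewrite mulr0.
  have [nF no_down] := d_supp g F dF gk ltF.
  have [h hF hg] := reduced_nonroot good_br nF LF bg.
  by have := no_down dg h hF; rewrite hg eqxx.
(* With k first in the block of minimum [lo g], every contributing downward edge
   from k ends in a root of F, that is in [lo g]. *)
have d_down g F : hi g = k -> down g -> below m F -> d g F = 0.
  move=> gk dg ltF; pose e G := if below m G then d g G else 0.
  suff : e F = 0 by rewrite /e ltF.
  apply: IHm; first exact: ltnW.
    move=> G; rewrite /e; case: ifP => [ltG /d_supp[]//|]; last by rewrite eqxx.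
    by move=> ->.
  move=> b r good_br; have lt_gm : (lo g < m)%N by have := lo_lt_hi g; rewrite gk.
  transitivity (\sum_(G | below m G) d g G * order_coef b r (ebase G)).
    rewrite [RHS]big_mkcond; apply: eq_bigr => G _; rewrite /e.
    by case: ifP; rewrite ?mul0r.
  have [bg|nbg] := eqVneq (b (lo g)) (lo g); last first.
    by rewrite big1 // => G ltG; rewrite dL0 // inE.
  have := S b r (lo g) 0 good_br bg lt_gm; rewrite (bigD1 g) ?gk //=.
  rewrite [X in _ + X]big1 ?addr0 => [S0|h /andP[/eqP hk neh]].
    apply: oppr_inj; rewrite oppr0 -[RHS]S0 -sumrN; apply: eq_bigr => G _.
    by rewrite /insert_sign bg eqxx dg leq0n mulN1r mulrN.
  apply: big1 => G ltG; rewrite /insert_sign; case: eqP => [bh|_]; last first.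
    by rewrite mul0r mulr0.
  case: (boolP (down h)) => dh; last by rewrite mul0r mulr0.
  rewrite mulrCA dL0 ?mulr0 // inE bh; apply: contraNneq neh => hg.
  by apply/eqP; apply: gen_eq; rewrite ?hk ?gk ?dh ?dg.
(* Compare the positions of k just before and just after [lo g]. *)
have d_all g F : hi g = k -> below m F -> d g F = 0.
  move=> gk ltF; have [dg|upg] := boolP (down g); first exact: d_down.
  pose e G := if below m G then d g G else 0.
  suff : e F = 0 by rewrite /e ltF.
  apply: IHm; first exact: ltnW.
    move=> G; rewrite /e; case: ifP => [ltG /d_supp[]//|]; last by rewrite eqxx.
    by move=> ->.
  move=> b r good_br; have lt_gm : (lo g < m)%N by have := lo_lt_hi g; rewrite gk.
  have [bb bv _ r_inj] := good_br.
  transitivity (\sum_(G | below m G) d g G * order_coef b r (ebase G)).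
    rewrite [RHS]big_mkcond; apply: eq_bigr => G _; rewrite /e.
    by case: ifP; rewrite ?mul0r.
  have S' p := S b r (b (lo g)) p good_br (bb _) (leq_ltn_trans (bv _) lt_gm).
  have := congr2 (fun x y => x - y) (S' (r (lo g)).+1) (S' (r (lo g))).
  rewrite subrr => S0; rewrite -[RHS]S0 -sumrB [RHS](bigD1 g) ?gk //= [X in _ + X]big1 ?addr0.
    rewrite -sumrB; apply: eq_bigr => G _.
    by rewrite /insert_sign eqxx (negPf upg) ltnn ltnSn mul1r mul0r mulr0 subr0.
  move=> h /andP[/eqP hk neh]; rewrite -sumrB; apply: big1 => G ltG.
  have [dh|uph] := boolP (down h); first by rewrite d_down // !mul0r subrr.
  rewrite -mulrBr -mulrBl /insert_sign (negPf uph).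
  case: eqP => _; last by rewrite subrr mul0r mulr0.
  (* As [r] is injective, both positions of [k] lie on the same side of every vertex other than
     [lo g]. *)
  suff -> : (r (lo h) < (r (lo g)).+1)%N = (r (lo h) < r (lo g))%N.
    by rewrite subrr mul0r mulr0.
  rewrite ltnS leq_eqVlt (inj_eq r_inj); case: eqP => // hg.
  by case/eqP: neh; apply: gen_eq; rewrite ?hk ?gk // (negPf upg) (negPf uph).
(* A set with nonzero coefficient has an edge at [k]; deleting it leaves a set covered by
   [d_all]. *)
have [//|cE] := eqVneq (c E) 0; have /andP[nE ltE] := c_supp E cE.
have /forall_inPn[g gE lemg] : ~~ below m E.
  by apply: contraNN cE => /c_top->.
have gk : hi g = k.
  apply: ord_inj; apply/eqP; rewrite eqn_leq -ltnS (belowP _ _ ltE) //=.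
  by rewrite leqNgt.
have ltF : below m (E :\ g).
  apply/belowP => h; rewrite in_setD1 => /andP[neh hE].
  have := belowP _ _ ltE h hE; rewrite ltnS leq_eqVlt => /predU1P[hm|//].
  have [inj_hi _] := reducedP _ nE; case/eqP: neh; apply: (inj_hi _ _ hE gE).
  by apply: ord_inj; rewrite hm gk.
have /eqP := d_all g (E :\ g) gk ltF.
by rewrite /d setD1K // mulf_eq0 signr_eq0 /= (negPf cE).
Qed.

End Independence.

(** * Spanning by rewriting modulo the ideal *)

Section Spanning.
Variable n : nat.
Implicit Types (i j k l : 'I_n) (g h : gen n) (E F : {set gen n}).
Local Notation extn := (exterior (gen n)).
Implicit Types x y z : extn.

Lemma ideal_rel x : is_rel (x : ext n) -> in_ideal (x : ext n).
Proof.
move=> relx; exists [:: ((1 : extn), x, (1 : extn))]; split=> [t|].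
  by rewrite inE => /eqP->.
by rewrite big_seq1 !wedgeE mul1r mulr1.
Qed.

Lemma ideal0 : in_ideal (0 : ext n).
Proof. by exists [::]; rewrite big_nil. Qed.

Lemma idealD x y : in_ideal (x : ext n) -> in_ideal (y : ext n) ->
  in_ideal (x + y : ext n).
Proof.
case=> s [s_rel ->] [t [t_rel ->]]; exists (s ++ t); split=> [u|].
  by rewrite mem_cat => /orP[/s_rel|/t_rel].
by rewrite big_cat.
Qed.

Lemma idealMl x y : in_ideal (y : ext n) -> in_ideal (x * y : ext n).
Proof.
case=> s [s_rel ->]; exists [seq (x * t.1.1 : ext n, t.1.2, t.2) | t <- s]; split.
  by move=> _ /mapP[t /s_rel rel ->].
rewrite big_map mulr_sumr; apply: eq_bigr => t _.
by rewrite !wedgeE !mulrA.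
Qed.

Lemma idealMr x y : in_ideal (x : ext n) -> in_ideal (x * y : ext n).
Proof.
case=> s [s_rel ->]; exists [seq (t.1, t.2 * y : ext n) | t <- s]; split.
  by move=> _ /mapP[t /s_rel rel ->].
rewrite big_map mulr_suml; apply: eq_bigr => t _.
by rewrite !wedgeE !mulrA.
Qed.

Lemma idealZ (a : rat) x : in_ideal (x : ext n) -> in_ideal (a *: x : ext n).
Proof. by move=> idx; rewrite -[x]mul1r scalerAl; apply: idealMl. Qed.

Definition spanned x : Prop := exists c : {set gen n} -> rat,
  in_ideal (x - \sum_(E | reduced E) c E *: ebase E : ext n).

Lemma spanned_ideal x : in_ideal (x : ext n) -> spanned x.
Proof.
move=> idx; exists (fun=> 0); rewrite big1 ?subr0 // => E _; exact: scale0r.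
Qed.

Lemma spanned_reduced E : reduced E -> spanned (ebase E).
Proof.
move=> nE; exists (fun F => (F == E)%:R); rewrite (bigD1 E) //= eqxx scale1r.
rewrite big1 => [|F /andP[_ /negPf->]]; last by rewrite scale0r.
by rewrite addr0 subrr; apply: ideal0.
Qed.

Lemma spannedD x y : spanned x -> spanned y -> spanned (x + y).
Proof.
case=> c idx [d idy]; exists (fun E => c E + d E).
have -> : \sum_(E | reduced E) (c E + d E) *: ebase E =
    \sum_(E | reduced E) c E *: ebase E + \sum_(E | reduced E) d E *: ebase E :> extn.
  by rewrite -big_split; apply: eq_bigr => E _; rewrite scalerDl.
by rewrite opprD addrACA; apply: idealD.
Qed.

Lemma spannedZ (a : rat) x : spanned x -> spanned (a *: x).
Proof.
case=> c idx; exists (fun E => a * c E).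
have -> : \sum_(E | reduced E) (a * c E) *: ebase E =
    a *: \sum_(E | reduced E) c E *: ebase E :> extn.
  by rewrite scaler_sumr; apply: eq_bigr => E _; rewrite scalerA.
by rewrite -scalerBr; apply: idealZ.
Qed.

(* The factor 3 lets a decrease of the sum of the endpoints absorb two new downward
   edges. *)
Definition edge_weight i j : nat := 3 * (i + j) + (j < i)%N.

Definition weight E : nat := \sum_(g in E) edge_weight (val g).1 (val g).2.

Lemma rgenE g : rgen (val g).1 (val g).2 = ebase [set g] :> extn.
Proof.
rewrite /rgen; case: insubP => [h _ hg|]; last by have := svalP g => ->.
by congr (emon [set _]); apply: val_inj; rewrite hg; case: (val g).
Qed.

Lemma rgen_exists i j : i != j -> exists g, val g = (i, j).
Proof. by move=> neij; exists (exist _ (i, j) neij). Qed.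

Lemma rgen_anti i j k l :
  (rgen i j : extn) * (rgen k l : extn) = - ((rgen k l : extn) * (rgen i j : extn)).
Proof.
have rgen_deg1 a b : rgen a b = 0 :> extn \/ exists g, rgen a b = ebase [set g] :> extn.
  by rewrite /rgen; case: insubP => [g _ _|_]; [right; exists g|left].
case: (rgen_deg1 i j) => [->|[g ->]]; first by rewrite mul0r mulr0 oppr0.
case: (rgen_deg1 k l) => [->|[h ->]]; first by rewrite mul0r mulr0 oppr0.
exact: xgen_anti.
Qed.

(** * Straightening of pairs of edges *)

Section Straightening.
(** In the application [M x] says that [x * ebase F] is spanned, for the set [F] of the remaining
    edges. *)
Variable (M : extn -> Prop).
Hypothesis M_B : forall x y, M x -> M y -> M (x - y).
Hypothesis M_rel : forall rho : ext n, is_rel rho -> M rho.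

Let r i j : extn := rgen i j.

Lemma M_0 : forall x, M x -> M 0.
Proof. by move=> x Mx; rewrite -(subrr x); apply: M_B. Qed.

Lemma M_N x : M x -> M (- x).
Proof. by move=> Mx; rewrite -sub0r; apply: M_B => //; apply: M_0 Mx. Qed.

Lemma M_D x y : M x -> M y -> M (x + y).
Proof. by move=> Mx /M_N My; rewrite -[y]opprK; apply: M_B. Qed.

Lemma M_Bl x y : M (x - y) -> M y -> M x.
Proof. by move=> Mxy My; rewrite -(subrK y x); apply: M_D. Qed.

(** Each three-term relation reads [x = y - z] modulo [M]; this lemma and [M_third] solve it for its
    outer terms. *)
Lemma M_first x y z : M (x - (y - z)) -> M y -> M z -> M x.
Proof. by move=> Mr My Mz; apply: M_Bl Mr _; apply: M_B. Qed.

Lemma M_third x y z : M (x - (y - z)) -> M x -> M y -> M z.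
Proof.
move=> Mr Mx My; rewrite -(subKr y z); apply: M_B => //.
by rewrite -[_ - _](subKr x); apply: M_B.
Qed.

Lemma M_rel1 i j k : i != j -> i != k -> j != k ->
  M (r i j * r i k - (r i j * r j k - r i k * r k j)).
Proof.
move=> ij ik jk; apply: M_rel; left; exists i, j, k; split=> //; left.
by rewrite !wedgeE.
Qed.

Lemma M_rel2 i j k : i != j -> i != k -> j != k ->
  M (r i k * r j k - (r i j * r j k - r j i * r i k)).
Proof.
move=> ij ik jk; apply: M_rel; left; exists i, j, k; split=> //; right.
by rewrite !wedgeE.
Qed.

Lemma M_opposite i j : i != j -> M (r i j * r j i).
Proof. by move=> ij; apply: M_rel; right; exists i, j; rewrite wedgeE. Qed.

Variables (i j k : 'I_n) (w : nat).
Hypothesis M_low : forall a b c d, a != b -> c != d ->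
  (edge_weight a b + edge_weight c d < w)%N -> M (r a b * r c d).

Hypotheses (neij : i != j) (ltik : (i < k)%N) (ltjk : (j < k)%N).

Let neik : i != k. Proof. by rewrite -val_eqE neq_ltn ltik. Qed.
Let nejk : j != k. Proof. by rewrite -val_eqE neq_ltn ltjk. Qed.

Ltac low_tac :=
  by apply: M_low; rewrite // 1?eq_sym //; unfold edge_weight in *; lia.

(** Here and in the next two cases, one relation trades an end [k] for a smaller vertex in both
    remaining products, which outweighs any new downward edge. *)
Lemma straighten_up_up : (edge_weight i k + edge_weight j k <= w)%N ->
  M (r i k * r j k).
Proof. by move=> w_def; apply: (M_first (M_rel2 neij neik nejk)); low_tac. Qed.

Lemma straighten_up_down : (edge_weight i k + edge_weight k j <= w)%N ->
  M (r i k * r k j).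
Proof. by move=> w_def; apply: (M_third (M_rel1 neij neik nejk)); low_tac. Qed.

Lemma straighten_down_down : (edge_weight k i + edge_weight k j <= w)%N ->
  M (r k i * r k j).
Proof.
have neki : k != i by rewrite eq_sym.
have nekj : k != j by rewrite eq_sym.
by move=> w_def; apply: (M_first (M_rel1 neki nekj neij)); low_tac.
Qed.

(** One relation leaves [r i k * r k j], which is heavier; a second one turns it into
    [r i j * r j k] and [r i j * r i k]. The former has the same sum of ends as the original pair
    and is lighter only by the missing downward edge. *)
Lemma straighten_in_mid : (i < j)%N -> (edge_weight k j + edge_weight i j <= w)%N ->
  M (r k j * r i j).
Proof.
move=> ltij w_def; have nekj : k != j by rewrite eq_sym.
rewrite /r rgen_anti; apply: M_N; apply: (M_first (M_rel2 neik neij nekj)).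
  by apply: (M_third (M_rel1 neij neik nejk)); low_tac.
by low_tac.
Qed.

(** As in [straighten_in_mid], a second relation removes the heavy product, here [r j k * r k i]; of
    the resulting pairs, [r j i * r j k] keeps the sum of ends but loses one downward edge. *)
Lemma straighten_path_mid : (i < j)%N -> (edge_weight k j + edge_weight j i <= w)%N ->
  M (r k j * r j i).
Proof.
move=> ltij w_def; have neji : j != i by rewrite eq_sym.
have neki : k != i by rewrite eq_sym.
apply: (M_third (M_rel2 nejk neji neki)); first by low_tac.
by apply: (M_third (M_rel1 neji nejk neik)); low_tac.
Qed.

End Straightening.

Lemma weight_insert g F : g \notin F ->
  weight (g |: F) = (edge_weight (val g).1 (val g).2 + weight F)%N.
Proof. by move=> gF; rewrite /weight big_setU1. Qed.

Lemma spanned_mul_edge g F : (g \notin F -> spanned (ebase (g |: F))) ->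
  spanned (ebase [set g] * ebase F).
Proof.
move=> IH; rewrite ebaseM /ebase_mul disjoints1.
case: ifP => [/IH/spannedZ|_]; first exact.
exact/spanned_ideal/ideal0.
Qed.

(** Strong induction on the weight: one violating pair is straightened while the remaining edges [F]
    are carried along as a factor. *)
Lemma spanned_base E : spanned (ebase E).
Proof.
have [w] := ubnP (weight E); elim: w E => // w IHw E; rewrite ltnS => leEw.
have [/spanned_reduced//|nnE] := boolP (reduced E).
suff [g [h [gE hE negh]]] : exists g h, [/\ g \in E, h \in E, g != h &
    spanned (ebase [set g] * ebase [set h] * ebase (E :\ g :\ h))].
  have hEg : h \in E :\ g by rewrite in_setD1 eq_sym negh.
  rewrite (ebase_setD1 gE) (ebase_setD1 hEg) -scalerAr mulrA => sp.
  by do 2!apply: spannedZ.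
have M_B F x y : spanned (x * ebase F) -> spanned (y * ebase F) ->
    spanned ((x - y) * ebase F).
  move=> Mx My; rewrite mulrBl -[- (y * _)]scaleN1r.
  by apply: spannedD => //; apply: spannedZ.
have M_rel F (rho : ext n) : is_rel rho -> spanned ((rho : extn) * ebase F).
  by move=> rel; apply/spanned_ideal/idealMr/ideal_rel.
(* A lighter pair multiplied by [F] either vanishes through a repeated edge or is, up to sign, a
   monomial of smaller weight. *)
have M_low g h F : (weight F + (edge_weight (val g).1 (val g).2 +
      edge_weight (val h).1 (val h).2) <= w)%N -> g \notin F -> h \notin F -> g != h ->
    forall a b c d, a != b -> c != d ->
    (edge_weight a b + edge_weight c d <
      edge_weight (val g).1 (val g).2 + edge_weight (val h).1 (val h).2)%N ->
    spanned ((rgen a b : extn) * (rgen c d : extn) * ebase F).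
  move=> leFw gF hF negh a b c d /rgen_exists[g' eg'] /rgen_exists[h' eh'] lt_w.
  have := rgenE g'; have := rgenE h'; rewrite eg' eh' /= => -> ->.
  rewrite -mulrA ebaseM {1}/ebase_mul disjoints1.
  case: ifPn => [h'F|_]; last by rewrite mulr0; apply/spanned_ideal/ideal0.
  rewrite -scalerAr; apply/spannedZ/spanned_mul_edge => g'F.
  apply: IHw; rewrite !weight_insert // eg' eh' /=; lia.
have [g gE [h hE bad]] : exists2 g, g \in E & exists2 h, h \in E &
    ~~ (((hi g == hi h) ==> (g == h)) && (down g ==> (lo g != hi h))).
  by case/forall_inPn: nnE => g gE /forall_inPn[h hE bad]; exists g => //; exists h.
have negh : g != h.
  apply: contraNneq bad => <-; rewrite !eqxx /= -val_eqE neq_ltn lo_lt_hi.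
  exact: implybT.
exists g, h; split=> //; set F := E :\ g :\ h.
have gF : g \notin F by rewrite !inE eqxx andbF.
have hF : h \notin F by rewrite !inE eqxx.
have EE : weight E = (weight F + (edge_weight (val g).1 (val g).2 +
      edge_weight (val h).1 (val h).2))%N.
  rewrite -{1}(setD1K gE) weight_insert ?inE ?eqxx //.
  rewrite -{1}(@setD1K _ h (E :\ g)) ?inE 1?eq_sym ?negh //.
  by rewrite weight_insert ?inE ?eqxx // addnA addnC.
have low := @M_low g h F; rewrite -EE in low; have {}low := low leEw gF hF negh.
rewrite -(rgenE g) -(rgenE h).
have lt_g := lo_lt_hi g; have lt_h := lo_lt_hi h.
rewrite !down_val in low *.
have MB := @M_B F; have MR := @M_rel F.
(* Either the two edges share their upper end, or the downward edge [g] ends in the upper end of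
   [h]. *)
case/nandP: bad; rewrite negb_imply => /andP[].
  move=> /eqP egh _; rewrite egh in lt_g low *.
  have [eqlo|neqlo] := eqVneq (lo g) (lo h).
    have neq_down : down g != down h.
      by apply: contraNneq negh => dgh; apply/eqP/gen_eq.
    have nelh : lo h != hi h by rewrite -val_eqE neq_ltn lt_h.
    rewrite eqlo; case: (down g) (down h) neq_down => [] [] //= _.
      by apply: (M_opposite MR); rewrite eq_sym.
    exact: (M_opposite MR).
  case: (down g) (down h) low => [] [] /= low.
  - exact: (straighten_down_down MB MR low).
  (* The pair is swapped so that the upward edge comes first. *)
  - rewrite rgen_anti mulNr -scaleN1r; apply: spannedZ.
    rewrite addnC in low; rewrite eq_sym in neqlo.
    exact: (straighten_up_down MB MR low).
  - exact: (straighten_up_down MB MR low).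
  - exact: (straighten_up_up MB MR low).
move=> dg /negPn/eqP lgh; rewrite dg lgh /= in lt_g low *.
case: (down h) low => /= low.
  apply: (straighten_path_mid MB MR low) => //.
  + by rewrite -val_eqE neq_ltn lt_h.
  + exact: ltn_trans lt_g.
have := @straighten_in_mid _ MB MR (lo h) (hi h) (hi g) _ low.
apply=> //.
- by rewrite -val_eqE neq_ltn lt_h.
- exact: ltn_trans lt_g.
Qed.

Lemma spanned_all x : spanned x.
Proof.
rewrite (ebase_expand x); apply: (big_ind spanned) => [||E _].
- exact/spanned_ideal/ideal0.
- exact: spannedD.
- exact/spannedZ/spanned_base.
Qed.

End Spanning.

(** * Reduced sets are exactly the Up-Down forests *)

Section UpDownForests.
Variable n : nat.
Implicit Types (u v x m : 'I_n) (g h : gen n) (E : {set gen n}) (S T : {set 'I_n}).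

Lemma minb_inj S u v : minb S u -> minb S v -> u = v.
Proof.
move=> /andP[uS /forall_inP minu] /andP[vS /forall_inP minv].
by apply/ord_inj/eqP; rewrite eqn_leq minu ?minv.
Qed.

Lemma trivIset_eq (P : {set {set 'I_n}}) S T v : trivIset P ->
  S \in P -> T \in P -> v \in S -> v \in T -> S = T.
Proof.
by move=> tiP SP TP vS vT; rewrite -(def_pblock tiP SP vS) (def_pblock tiP TP vT).
Qed.

Lemma upward_val g : ((val g).1 < (val g).2)%N ->
  [/\ ~~ down g, lo g = (val g).1 & hi g = (val g).2].
Proof. by move=> lt_g; rewrite /down /lo /hi lt_g -leqNgt (ltnW lt_g). Qed.

Lemma downward_val g : ((val g).2 < (val g).1)%N ->
  [/\ down g, lo g = (val g).2 & hi g = (val g).1].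
Proof. by move=> lt_g; rewrite /down /lo /hi [(_ < (val g).2)%N]ltnNge (ltnW lt_g). Qed.

(** Up edges enter vertices that are not minimal in their block, one edge each, while Down edges
    leave minima; hence upper ends are distinct. The target of a Down edge is minimal in its block
    of either partition, so it is no upper end. *)
Lemma updown_reduced E : updownb E -> reduced E.
Proof.
case/existsP=> P /existsP[U /existsP[Q /existsP[D]]].
case/and5P=> /and3P[_ tiP _] /forall_inP upU /and3P[/eqP covQ tiQ _] /forall_inP downD /eqP EE.
have upE S g : S \in P -> g \in U S -> [/\ ~~ down g, lo g \in S, hi g \in S &
    forall h, h \in U S -> hi h = hi g -> h = g].
  move=> /upU/and4P[/forall_inP ends _ /forall_inP uniq_in _] gU.
  have {}ends h : h \in U S -> [/\ ~~ down h, lo h \in S, hi h \in S & hi h = (val h).2].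
    by move=> /ends/and3P[h1 h2 /upward_val[? -> ->]].
  have [ndg loS hiS hig] := ends g gU; split=> // h hU hgh.
  have := uniq_in _ hiS; rewrite implybE negbK => /orP[/andP[_ /forall_inP/(_ _ loS)]|].
    by rewrite leqNgt lo_lt_hi.
  case/cards1P => e eqe; have [_ _ _ hih] := ends h hU.
  have : g \in [set e0 in U S | (val e0).2 == hi g] by rewrite inE gU hig eqxx.
  have : h \in [set e0 in U S | (val e0).2 == hi g] by rewrite inE hU -hgh hih eqxx.
  by rewrite eqe !inE => /eqP-> /eqP->.
have upmin S g v : S \in P -> g \in U S -> v \in minima P -> v != hi g.
  move=> SP gU; rewrite inE => /exists_inP[S' S'P minv]; apply/eqP => vg.
  have [_ loS hiS _] := upE S g SP gU; have [vS' /forall_inP le_v] := andP minv.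
  rewrite vg in vS' le_v; rewrite (trivIset_eq tiP S'P SP vS' hiS) in le_v.
  by have := le_v _ loS; rewrite leqNgt lo_lt_hi.
have dnE T g : T \in Q -> g \in D T ->
    [/\ down g, hi g \in T, minb T (lo g), hi g \in minima P & lo g \in minima P].
  move=> TQ; have /existsP[mu /andP[minT /eqP ->]] := downD T TQ.
  rewrite inE => /and3P[g1T g1mu /eqP g2mu].
  have [muT /forall_inP le_mu] := andP minT.
  have /downward_val[dg -> ->] : ((val g).2 < (val g).1)%N.
    by rewrite g2mu ltn_neqAle le_mu // andbT eq_sym.
  by rewrite g2mu -covQ; split=> //; apply/bigcupP; exists T.
have inE_E g : g \in E ->
    (exists2 S, S \in P & g \in U S) \/ (exists2 T, T \in Q & g \in D T).
  by rewrite EE in_setU => /orP[]/bigcupP[S SP gS]; [left|right]; exists S.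
apply/reducedP; split.
  move=> g h /inE_E[[S SP gS]|[T TQ gT]] /inE_E[[S' S'P hS]|[T' T'Q hT]] ghi.
  - have [_ _ hiS uni] := upE S g SP gS; have [_ _ hiS' _] := upE S' h S'P hS.
    rewrite -ghi in hiS'; rewrite (trivIset_eq tiP S'P SP hiS' hiS) in hS.
    by apply/esym/uni.
  - have [_ _ _ hmin _] := dnE T' h T'Q hT.
    by have := upmin S g _ SP gS hmin; rewrite ghi eqxx.
  - have [_ _ _ gmin _] := dnE T g TQ gT.
    by have := upmin S' h _ S'P hS gmin; rewrite ghi eqxx.
  - have [dg hgT mg _ _] := dnE T g TQ gT; have [dh hhT mh _ _] := dnE T' h T'Q hT.
    rewrite -ghi in hhT; rewrite (trivIset_eq tiQ T'Q TQ hhT hgT) in mh.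
    by apply: gen_eq => //; [apply: minb_inj mg mh|rewrite dg dh].
move=> g h /inE_E[[S SP gS]|[T TQ gT]].
  by have [/negPf-> //] := upE S g SP gS.
have [dg hgT mg _ lmin] := dnE T g TQ gT.
move=> /inE_E[[S' S'P hS]|[T' T'Q hT]] _; first exact: upmin hS lmin.
have [dh hhT mh _ _] := dnE T' h T'Q hT; apply/eqP => lgh.
have [lT _] := andP mg; rewrite -lgh in hhT.
rewrite -(trivIset_eq tiQ TQ T'Q lT hhT) in mh.
by have := lo_lt_hi h; rewrite -lgh (minb_inj mg mh) ltnn.
Qed.

Section ForestOfReduced.
Variables (E : {set gen n}) (nE : reduced E).

(** The default [v] turns vertices without a suitable edge into fixed points, so that roots can be
    found by iteration. *)
Definition parent (q : pred (gen n)) v : 'I_n :=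
  if [pick g in E | q g && (hi g == v)] is Some g then lo g else v.

Lemma parent_edge (q : pred (gen n)) g : g \in E -> q g -> parent q (hi g) = lo g.
Proof.
move=> gE qg; rewrite /parent; case: pickP => [h /and3P[hE _ /eqP hg]|/(_ g)].
  by have [inj_hi _] := reducedP _ nE; rewrite (inj_hi h g).
by rewrite gE qg eqxx.
Qed.

Lemma parent_cases (q : pred (gen n)) v :
  (exists g, [/\ g \in E, q g, hi g = v & parent q v = lo g]) \/ parent q v = v.
Proof.
rewrite /parent; case: pickP => [g /and3P[gE qg /eqP gv]|_]; last by right.
by left; exists g.
Qed.

Lemma parent_le (q : pred (gen n)) v : (parent q v <= v)%N.
Proof.
by case: (parent_cases q v) => [[g [_ _ <- ->]]|->] //; apply/ltnW/lo_lt_hi.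
Qed.

Lemma parent_id (q : pred (gen n)) v :
  (forall g, g \in E -> q g -> hi g != v) -> parent q v = v.
Proof.
move=> no; case: (parent_cases q v) => [[g [gE qg gv _]]|//].
by have := no g gE qg; rewrite gv eqxx.
Qed.

Let up : pred (gen n) := fun g => ~~ down g.
Let par := parent up.
Let dpar := parent (@down n).
Let root v := iter n par v.

(** Each step that moves lowers the vertex by at least one, so [n] steps from a vertex below [n] end
    in a fixed point. *)
Lemma par_root v : par (root v) = root v.
Proof.
have step j : (iter j par v + j <= v)%N \/ par (iter j par v) = iter j par v.
  elim: j => [|j [IHj|IHj]]; [by left; rewrite addn0| |by right; rewrite iterS !IHj].
  rewrite iterS; case: (parent_cases up (iter j par v)) => [[g [_ _ gv eqp]]|fixp].
    left; have := lo_lt_hi g; rewrite gv (eqp : par _ = lo g); lia.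
  by right; rewrite /par !fixp.
case: (step n) => // le_v; have := ltn_ord v; lia.
Qed.

Lemma root_par v : root (par v) = root v.
Proof. by rewrite /root -iterSr iterS par_root. Qed.

Lemma root_fix v : par v = v -> root v = v.
Proof. exact: iter_fix. Qed.

Lemma root_le v : (root v <= v)%N.
Proof.
suff le_v j : (iter j par v <= v)%N by apply: le_v.
by elim: j => //= j; apply: leq_trans; apply: parent_le.
Qed.

Let P := preim_partition root [set: 'I_n].

Lemma mem_block S : S \in P -> exists x, forall v, (v \in S) = (root x == root v).
Proof. by case/imsetP => x _ ->; exists x => v; rewrite !inE. Qed.

(** [root] never increases a vertex and is constant on a block, so its value is the minimum
    there. *)
Lemma minb_block S x m : (forall v, (v \in S) = (root x == root v)) ->
  minb S m = (m == root x).
Proof.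
move=> memS; have rx : root (root x) = root x by apply/root_fix/par_root.
apply/idP/eqP => [/andP[mS /forall_inP le_m]|->].
  have rS : root x \in S by rewrite memS rx.
  apply/ord_inj/eqP; rewrite eqn_leq le_m //= (eqP (_ : root x == root m)) ?root_le //.
  by rewrite -memS.
rewrite /minb memS rx eqxx; apply/forall_inP => v; rewrite memS => /eqP ->.
exact: root_le.
Qed.

Lemma in_minima m : (m \in minima P) = (par m == m).
Proof.
rewrite inE; apply/exists_inP/eqP => [[S /mem_block[x memS]]|fixm].
  by rewrite (minb_block _ memS) => /eqP ->; apply: par_root.
exists (pblock P m).
  by rewrite pblock_mem // (cover_partition (preim_partitionP _ _)) inE.
have PmP : pblock P m \in P.
  by rewrite pblock_mem // (cover_partition (preim_partitionP _ _)) inE.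
have [x memS] := mem_block PmP; rewrite (minb_block _ memS).
have : m \in pblock P m by rewrite mem_pblock (cover_partition (preim_partitionP _ _)) inE.
by rewrite memS (root_fix fixm) eq_sym.
Qed.

Let U := [ffun S : {set 'I_n} => [set g in E | up g & lo g \in S]].

(** [hi] matches the edges of the block with its vertices other than the root, which gives both the
    edge count and the unique incoming edges. Following parents downwards connects every vertex to
    the root. *)
Lemma upb_block S : S \in P -> upb S (U S).
Proof.
move=> SP; have [x memS] := mem_block SP.
have UE g : g \in U S -> [/\ g \in E, val g = (lo g, hi g), lo g \in S & hi g \in S].
  rewrite ffunE inE => /and3P[gE upg loS]; split=> //.
    by rewrite {1}down_val (negPf upg).
  by rewrite memS -(root_par (hi g)) /par parent_edge // -memS.
have [inj_hi _] := reducedP _ nE.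
have nonmin v : v \in S -> v != root x -> exists2 g, g \in U S & hi g = v.
  move=> vS; case: (parent_cases up v) => [[g [gE upg gv pv]] _|fixv].
    exists g => //; rewrite ffunE inE gE upg /=; have := vS.
    by rewrite !memS -(root_par v) /par pv.
  by have := vS; rewrite memS (root_fix fixv) eq_sym => ->.
apply/and4P; split.
- apply/forall_inP => g /UE[_ -> /= -> ->]; exact: lo_lt_hi.
- have xS : root x \in S by rewrite memS (root_fix (par_root x)).
  rewrite (cardsD1 (root x) S) xS /= -(_ : @hi n @: U S = S :\ root x).
    by rewrite card_in_imset // => g h /UE[gE _ _ _] /UE[hE _ _ _]; apply: inj_hi.
  apply/setP => v; rewrite in_setD1; apply/imsetP/andP => [[g gU ->]|[vx vS]].
    have [gE _ loS hiS] := UE g gU; split=> //.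
    apply: contraTneq loS => gx; rewrite memS; apply/eqP => rx.
    have := lo_lt_hi g; rewrite gx rx ltnNge root_le //.
  by have [g gU gv] := nonmin v vS vx; exists g.
- apply/forall_inP => v vS; apply/implyP; rewrite (minb_block _ memS) => vx.
  have [g gU gv] := nonmin v vS vx; apply/cards1P; exists g.
  apply/setP => h; rewrite !inE; apply/andP/eqP => [[hU]|->].
    have [hE -> _ _] := UE h hU; have [gE _ _ _] := UE g gU => /= /eqP hv.
    by apply: inj_hi; rewrite ?hv ?gv.
  by have [_ -> _ _] := UE g gU; rewrite /= gv eqxx.
apply/forall_inP => v vS; apply/forall_inP => m _; apply/implyP.
rewrite (minb_block _ memS) => /eqP -> {m}.
have [w] := ubnP (v : nat); elim: w v vS => // w IHw v vS; rewrite ltnS => lev.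
have [->|/(nonmin v vS)[g gU gv]] := eqVneq v (root x); first exact: connect0.
have [_ eg loS _] := UE g gU.
apply: (connect_trans (y := lo g)).
  by apply: IHw => //; apply: leq_trans lev; rewrite -gv lo_lt_hi.
by apply/connect1/exists_inP; exists g; rewrite // eg gv eqxx.
Qed.

(** In a reduced set the target of a downward edge is no upper end, so [par] fixes it. *)
Lemma dpar_min v : v \in minima P -> dpar v \in minima P.
Proof.
rewrite /dpar; case: (parent_cases (@down n) v) => [[g [gE dg _ ->]] _|-> //].
rewrite in_minima; apply/eqP/parent_id => h hE _.
by have [_ no_down] := reducedP _ nE; rewrite eq_sym; apply: no_down dg.
Qed.

Lemma dpar_idem v : dpar (dpar v) = dpar v.
Proof.
case: (parent_cases (@down n) v) => [[g [gE dg _ eqv]]|eqv]; rewrite /dpar !eqv //.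
apply: parent_id => h hE _.
by have [_ no_down] := reducedP _ nE; rewrite eq_sym; apply: no_down dg.
Qed.

Let Q := preim_partition dpar (minima P).
Let D := [ffun T : {set 'I_n} => [set g in E | down g & hi g \in T]].

Lemma downb_block T : T \in Q -> downb T (D T).
Proof.
case/imsetP => x xmin eT.
have memT v : (v \in T) = (v \in minima P) && (dpar x == dpar v) by rewrite eT inE.
apply/existsP; exists (dpar x); apply/andP; split.
  rewrite /minb memT dpar_min // dpar_idem eqxx; apply/forall_inP => v.
  by rewrite memT => /andP[_ /eqP ->]; apply: parent_le.
apply/eqP/setP => g; rewrite ffunE !inE; apply/and3P/and3P => [[gE dg hiT]|[]].
  rewrite down_val dg /= hiT.
  have : dpar x = lo g.
    by move: hiT; rewrite memT /dpar => /andP[_ /eqP->]; rewrite parent_edge.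
  by move=> ->; rewrite eqxx -val_eqE neq_ltn lo_lt_hi orbT.
(* Conversely, an edge from the group to [dpar x] has to coincide with the edge selected by [dpar]
   at its source. *)
move=> g1T g1x /eqP g2x; have := g1T; rewrite memT => /andP[_ /eqP xg1].
case: (parent_cases (@down n) (val g).1) => [[h [hE dh hg hl]]|fixg]; last first.
  by move: g1x; rewrite xg1 /dpar fixg eqxx.
suff <- : h = g by rewrite dh hE hg.
apply: val_inj; rewrite down_val dh hg -hl -/dpar.
by rewrite -xg1 -g2x; case: (val g).
Qed.

(** The blocks are the fibres of [root] and the groups of minima the fibres of [dpar]; upward edges
    go to the first partition, downward edges to the second. *)
Lemma reduced_updown : updownb E.
Proof.
apply/existsP; exists P; apply/existsP; exists U; apply/existsP; exists Q.
apply/existsP; exists D; apply/and5P; split.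
- exact: preim_partitionP.
- by apply/forall_inP => S; apply: upb_block.
- exact: preim_partitionP.
- by apply/forall_inP => T; apply: downb_block.
have covP : cover P = setT by apply: cover_partition; apply: preim_partitionP.
have covQ : cover Q = minima P by apply: cover_partition; apply: preim_partitionP.
apply/eqP/setP => g; rewrite in_setU; apply/idP/orP => [gE|]; last first.
  by case=> /bigcupP[S _]; rewrite ffunE inE => /and3P[].
have [dg|upg] := boolP (down g); [right|left]; apply/bigcupP.
  (* By injectivity of [hi] no upward edge enters the source of a downward edge, which is therefore
     the minimum of its block. *)
  have hmin : hi g \in cover Q.
    rewrite covQ in_minima; apply/eqP/parent_id => h hE uph.
    apply: contraNneq uph => hg.
    by have [inj_hi _] := reducedP _ nE; rewrite (inj_hi h g).
  exists (pblock Q (hi g)); first exact: pblock_mem.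
  by rewrite ffunE inE gE dg mem_pblock.
have lmem : lo g \in cover P by rewrite covP inE.
exists (pblock P (lo g)); first exact: pblock_mem.
by rewrite ffunE inE gE /up upg mem_pblock.
Qed.

End ForestOfReduced.

Lemma updownE E : updownb E = reduced E.
Proof. by apply/idP/idP; [apply: updown_reduced|apply: reduced_updown]. Qed.

End UpDownForests.

Theorem theorem5p15 (n : nat) :
  (forall x : ext n, exists c : {set gen n} -> rat,
     in_ideal (x - \sum_(E | updownb E) scal (c E) (emon E))) /\
  (forall c : {set gen n} -> rat,
     in_ideal (\sum_(E | updownb E) scal (c E) (emon E)) ->
     forall E, updownb E -> c E = 0).
Proof.
have sumE (c : {set gen n} -> rat) : \sum_(E | updownb E) scal (c E) (emon E) =
    \sum_(E | reduced E) c E *: (ebase E : exterior (gen n)) :> ext n.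
  rewrite (eq_bigl _ _ (@updownE n)); apply: eq_bigr => E _.
  by apply/ffunP => T; rewrite !ffunE.
split=> [x|c]; first by have [c idx] := spanned_all x; exists c; rewrite sumE.
rewrite sumE => idc E; rewrite updownE => redE.
(* Extension by zero gives a family supported on reduced sets; for [m = n] the bound [below] is
   automatic. *)
pose c' F := if reduced F then c F else 0.
suff : c' E = 0 by rewrite /c' redE.
apply: (reduced_indep (leqnn n)) => [F|b r [_ _ _ r_inj]].
  rewrite /c'; case: ifP => [_ _|]; last by rewrite eqxx.
  by apply/belowP => g _; apply: ltn_ord.
have := elift_ideal b r_inj idc => /(congr1 (fun y : exterior _ => y (nonroots b))).
rewrite ffunE -/(order_coef b r _) linear_sum big_mkcond => sum0.
rewrite -[RHS]sum0; apply: eq_bigr => F _; rewrite /c'.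
by case: ifP => _; rewrite ?mul0r // linearZ.
Qed.
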